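(* Let $k\ge 1$, let $\delta_0>0$, and let $K\subseteq\mathbb{P}^k$ be a compact set. Then there exists a family of functions $(\chi_\delta)_{0<\delta<\delta_0}$ such that for every $0<\delta<\delta_0$ the function $\chi_\delta:\mathbb{P}^k\to[0,1]$ is smooth, $\chi_\delta\equiv 1$ on $K$, and $\operatorname{supp}(\chi_\delta)\subseteq K_\delta$; moreover, for every integer $\alpha\ge 0$ there is a constant $c_\alpha>0$, independent of $\delta$, such that $$\|\chi_\delta\|_{C^\alpha}\le c_\alpha\,\delta^{-\alpha}\qquad\text{for all }0<\delta<\delta_0 .$$
   Context: $\mathbb{P}^k$ denotes complex projective space of complex dimension $k$, and distances on $\mathbb{P}^k$ are measured with respect to the Fubini-Study metric. For a compact set $K\subseteq\mathbb{P}^k$ and $\delta>0$, $K_\delta$ denotes the set of points of $\mathbb{P}^k$ whose Fubini-Study distance to $K$ is less than $\delta$. The support $\operatorname{supp}(\chi)$ is the closure of $\{\chi\neq 0\}$. $\|\cdot\|_{C^\alpha}$ denotes the usual $C^\alpha$-norm of functions on the compact manifold $\mathbb{P}^k$ (the supremum of the absolute values of all real partial derivatives of order at most $\alpha$, computed in a fixed finite family of local coordinate charts restricted to compact subsets covering $\mathbb{P}^k$; different choices give equivalent norms). *)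

(* Defs.v *)
From HB Require Import structures.
From mathcomp Require Import all_boot all_order all_algebra.
From mathcomp Require Import complex.
From mathcomp Require Import all_classical all_reals all_analysis.

Set Implicit Arguments.
Unset Strict Implicit.
Unset Printing Implicit Defensive.
Import Order.TTheory GRing.Theory Num.Theory.
Import numFieldNormedType.Exports.
Local Open Scope classical_set_scope.
Local Open Scope ring_scope.

(** A vector of C^n is given in real coordinates by (Re z, Im z) in R^(n + n). *)
Definition of_real_coords (R : realType) (n : nat) (x : 'rV[R]_(n + n)) :
    'rV[R[i]]_n :=
  \row_j (x 0 (lshift n j) +i* x 0 (rshift n j))%C.

(** P^k is the set of complex lines through the origin of C^(k+1). *)
Definition cproj (R : realType) (k : nat) :=
  {L : {vspace 'rV[R[i]]_k.+1} | \dim L == 1%N}.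

HB.instance Definition _ (R : realType) (k : nat) := Choice.on (cproj R k).

Section Charts.
Context {R : realType} {k : nat}.

Lemma dim_line (z : 'rV[R[i]]_k.+1) : z != 0 -> \dim <[z]>%VS == 1%N.
Proof. by move=> z0; rewrite dim_vline z0. Qed.

Definition line (z : 'rV[R[i]]_k.+1) (z0 : z != 0) : cproj R k :=
  exist _ <[z]>%VS (dim_line z0).

(** Homogeneous coordinates (w_0, ..., 1, ..., w_(k-1)), with 1 at place [j]. *)
Definition affine_vec (j : 'I_k.+1) (x : 'rV[R]_(k + k)) : 'rV[R[i]]_k.+1 :=
  \row_l (if unlift j l is Some m then of_real_coords x 0 m else 1).

Lemma affine_vec_neq0 (j : 'I_k.+1) (x : 'rV[R]_(k + k)) : affine_vec j x != 0.
Proof.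
apply/eqP => /rowP /(_ j); rewrite !mxE unlift_none => /eqP.
by rewrite oner_eq0.
Qed.

(** Inverse of the standard affine chart {z_j != 0} -> C^k = R^(2k). *)
Definition affine_param (j : 'I_k.+1) (x : 'rV[R]_(k + k)) : cproj R k :=
  line (affine_vec_neq0 j x).

(** The manifold topology: [A] is open iff its trace on each affine chart is. *)
Definition cproj_open : set_system (cproj R k) :=
  [set A | forall j, open (affine_param j @^-1` A)].

Let cproj_openT : cproj_open setT.
Proof. by move=> j; rewrite preimage_setT; exact: openT. Qed.

Let cproj_openI : setI_closed cproj_open.
Proof. by move=> A B oA oB j; rewrite preimage_setI; apply: openI. Qed.

Let cproj_open_bigU (I : Type) (f : I -> set (cproj R k)) :
  (forall i, cproj_open (f i)) -> cproj_open (\bigcup_i f i).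
Proof.
move=> of_ j; rewrite preimage_bigcup.
by apply: bigcup_open => i _; exact: of_.
Qed.

HB.instance Definition _ := isOpenTopological.Build (cproj R k)
  cproj_openT cproj_openI cproj_open_bigU.

End Charts.

(** The partial derivative d_(i_1) ... d_(i_m) of [g], for [s = [:: i_1; ...; i_m]]. *)
Definition iter_partial (R : realType) (n : nat) (g : 'rV[R]_n -> R)
    (s : seq 'I_n) : 'rV[R]_n -> R :=
  foldr (fun i h => 'D_('e_i) h) g s.

Definition smooth_on_Rn (R : realType) (n : nat) (g : 'rV[R]_n -> R) : Prop :=
  forall s : seq 'I_n,
    continuous (iter_partial g s) /\
    forall x i, derivable (iter_partial g s) x 'e_i.

Section ProjectiveSpace.
Context {R : realType} {k : nat}.
Implicit Types (x y : cproj R k) (K : set (cproj R k)) (f : cproj R k -> R).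

Definition smooth f : Prop :=
  forall j : 'I_k.+1, smooth_on_Rn (f \o affine_param j).

(** The closed unit polydiscs of the k+1 affine charts cover P^k: the line
    spanned by z lies in that of any chart j with |z_j| maximal. *)
Definition closed_polydisc : set 'rV[R]_(k + k) :=
  [set w | forall m : 'I_k, `|of_real_coords w 0 m| <= 1].

Definition Calpha_norm (alpha : nat) f : \bar R :=
  ereal_sup [set v | exists j : 'I_k.+1, exists s : seq 'I_(k + k),
    exists w : 'rV[R]_(k + k),
    [/\ (size s <= alpha)%N, closed_polydisc w &
        v = `|iter_partial (f \o affine_param j) s w|%:E]].

Definition hdot (z w : 'rV[R[i]]_k.+1) : R[i] := \sum_l z 0 l * (w 0 l)^*%C.

(** Fubini-Study length of the image in P^k of the tangent vector [v] at [z]. *)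
Definition fs_norm (z v : 'rV[R[i]]_k.+1) : R :=
  Num.sqrt (complex.Re
    ((hdot z z * hdot v v - hdot v z * hdot z v) / hdot z z ^+ 2)).

(** Curves of P^k are described by lifts to C^(k+1) minus the origin, in real
    coordinates; only their restriction to [0, 1] matters, and every C^1 curve
    [0, 1] -> P^k has a C^1 lift, which extends to a C^1 map on R. *)
Definition fs_path x y (z : R -> 'rV[R]_(k.+1 + k.+1)) : Prop :=
  [/\ (forall t, derivable z t 1) /\ continuous (derive1 z),
      forall t, 0 <= t <= 1 -> of_real_coords (z t) != 0,
      <[of_real_coords (z 0%R)]>%VS = sval x &
      <[of_real_coords (z 1%R)]>%VS = sval y].

Definition fs_length (z : R -> 'rV[R]_(k.+1 + k.+1)) : \bar R :=
  (\int[lebesgue_measure]_(t in `[0%R, 1%R])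
     (fs_norm (of_real_coords (z t)) (of_real_coords (derive1 z t)))%:E)%E.

Definition fs_dist x y : \bar R :=
  ereal_inf [set fs_length z | z in fs_path x y].

Definition fs_dist_set x K : \bar R := ereal_inf [set fs_dist x y | y in K].

Definition fs_nbhd K (delta : R) : set (cproj R k) :=
  [set x | (fs_dist_set x K < delta%:E)%E].

Definition supp f : set (cproj R k) := closure [set x | f x != 0].

End ProjectiveSpace.

(* Main.v *)
Require Import Defs.
From HB Require Import structures.
From mathcomp Require Import all_boot all_order all_algebra.
From mathcomp Require Import complex.
From mathcomp Require Import all_classical all_reals all_analysis.
From mathcomp Require Import ring lra.
Import Order.TTheory GRing.Theory Num.Theory.
Import numFieldNormedType.Exports.
Local Open Scope classical_set_scope.
Local Open Scope ring_scope.

Set Implicit Arguments.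
Unset Strict Implicit.
Unset Printing Implicit Defensive.

(** The entries of the orthogonal projections z z^* / |z|^2 embed P^k into a
    Euclidean space R^N; in every affine chart they are rational functions without
    poles, and they control the Fubini-Study distance from above, since the
    straight path from z to its projection on a line y stays away from 0 and has
    length at most a constant times the distance of the two projections.
    At scale e, proportional to delta, take the smooth partition of unity of R^N
    made of the products of translates of one bump function along the grid
    e Z^N, and let chi be the sum of the functions whose cell meets K.  Each
    derivative costs a factor 1/e, and at each point the number of nonzero terms
    is bounded independently of e. *)

(** * Families of functions with scaled derivative bounds *)

(* Each derivative along a direction [v j] costs a factor [1 / e i]; the
   constants are uniform in the family index [i], which is what makes the final
   bounds independent of delta. *)
Fixpoint tame {R : realType} {V : normedModType R} {J I : Type} (v : J -> V)
    (B : set V) (e : I -> R) (m : nat) (W f : I -> V -> R) : Prop :=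
  [/\ forall i, continuous (f i),
      exists c, 0 <= c /\ forall i x, B x -> `|f i x| <= c * W i x &
      if m is m'.+1 then forall j,
        (forall i x, derivable (f i) x (v j)) /\
        tame v B e m' (fun i x => (e i)^-1 * W i x) (fun i => 'D_(v j) (f i))
      else True].

Lemma derive_ext (R : realType) (V : normedModType R) (f g : V -> R) (x v : V) d :
  is_derive x v f d -> f =1 g -> is_derive x v g d.
Proof. by move=> ? /funext <-. Qed.

Lemma derive_along_line (R : realType) (V : normedModType R) (g : V -> R) (x v : V) :
  (derivable g x v <-> derivable (fun s : R => g (s *: v + x)) 0 1) /\
  'D_v g x = 'D_1 (fun s : R => g (s *: v + x)) 0.
Proof.
suff E : (fun t : R => t^-1 *: ((g \o shift x) (t *: v) - g x)) =
    (fun t : R => t^-1 *: (((fun s : R => g (s *: v + x)) \o shift 0) (t *: (1 : R))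
      - g ((0 : R) *: v + x))).
  by rewrite /derivable /derive E.
by apply/funext => t /=; rewrite addr0 scale0r add0r [t *: 1]mulr1.
Qed.

(** Only a directional derivative of [f] is at hand, so the chain rule is applied on the line
    [s *: v + x], where derivability in one real variable gives differentiability. *)
Lemma is_derive_comp1 (R : realType) (V : normedModType R) (h : R -> R)
    (f : V -> R) (x v : V) (dh df : R) :
  is_derive (f x) 1 h dh -> is_derive x v f df -> is_derive x v (h \o f) (dh * df).
Proof.
move=> [{}dh <-] [{}df <-].
have [fd ->] := derive_along_line f x v.
have u0 : f (0 *: v + x) = f x by rewrite scale0r add0r.
move: fd dh; rewrite -u0; set u : R -> R := fun s => f (s *: v + x) => fd dh.
have du : derivable u 0 1 by apply/fd.
have dhu : derivable (h \o u) 0 1.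
  by apply/derivable1_diffP/differentiable_comp; exact/derivable1_diffP.
have [hd hE] := derive_along_line (h \o f) x v.
apply: DeriveDef; first exact/hd.
by rewrite hE -derive1E (derive1_comp du dh) !derive1E.
Qed.

(** * Closure properties of tame families *)

Section TameTheory.
Context {R : realType} {V : normedModType R} {J I : Type}.
Variables (v : J -> V) (B : set V).
Implicit Types (e : I -> R) (W f g : I -> V -> R).

Lemma tame_cont e m W f : tame v B e m W f -> forall i, continuous (f i).
Proof. by case: m => [|m] []. Qed.

Lemma tameS e m W f : tame v B e m.+1 W f -> tame v B e m W f.
Proof.
elim: m W f => [|m IH] W f [cf bf df]; first by split.
split=> // j; have [? ?] := df j; split => //.
exact: IH.
Qed.

(** A derivative of order [r] is measured against [W] times [r] factors of the inverse scale, and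
    these only grow when the scale shrinks. *)
Lemma le_tame e e' m W W' f : (forall i, 0 < e' i <= e i) ->
  (forall i x, B x -> 0 <= W i x <= W' i x) ->
  tame v B e m W f -> tame v B e' m W' f.
Proof.
move=> ee'; elim: m W W' f => [|m IH] W W' f WW' [cf [c [c0 bf]] df]; split => //.
- exists c; split=> // i x Bx; apply: le_trans (bf i x Bx) _.
  by rewrite ler_wpM2l//; have /andP[] := WW' i x Bx.
- exists c; split=> // i x Bx; apply: le_trans (bf i x Bx) _.
  by rewrite ler_wpM2l//; have /andP[] := WW' i x Bx.
move=> j; have [? ?] := df j; split => //; apply: IH; last by eassumption.
move=> i x Bx; have /andP[W0 WW] := WW' i x Bx; have /andP[e0 ee] := ee' i.
have e0' : 0 < e i by exact: lt_le_trans ee.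
rewrite mulr_ge0// ?invr_ge0 ?(ltW e0')//= ler_pM// ?invr_ge0 ?(ltW e0')//.
by rewrite lef_pV2// posrE.
Qed.

Lemma tame_is_derive e m W f : tame v B e m.+1 W f ->
  forall i x j, is_derive x (v j) (f i) ('D_(v j) (f i) x).
Proof. by move=> [_ _ df] i x j; apply: derivableP; exact: (df j).1. Qed.

(** Introduction rule: explicit derivatives [df] may replace the terms ['D_(v j) (f i)], to which
    they are equal as functions. *)
Lemma tame_step e m W f (df : J -> I -> V -> R) :
  (forall i, continuous (f i)) ->
  (exists c, 0 <= c /\ forall i x, B x -> `|f i x| <= c * W i x) ->
  (forall j i x, is_derive x (v j) (f i) (df j i x)) ->
  (forall j, tame v B e m (fun i x => (e i)^-1 * W i x) (df j)) ->
  tame v B e m.+1 W f.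
Proof.
move=> cf bf isd tdf; split=> // j; split.
  by move=> i x; have [] := isd j i x.
suff -> : (fun i => 'D_(v j) (f i)) = df j by [].
by apply/funext => i; apply/funext => x; have [_ ->] := isd j i x.
Qed.

Lemma tame_cst e m W (a : I -> R) c :
  (forall i, 0 < e i) -> (forall i x, B x -> 0 <= W i x) -> 0 <= c ->
  (forall i x, B x -> `|a i| <= c * W i x) ->
  tame v B e m W (fun i => cst (a i)).
Proof.
move=> e0; elim: m W a c => [|m IH] W a c W0 c0 aW.
  by split=> //; [move=> i; exact: cst_continuous|exists c].
apply: (@tame_step _ _ _ _ (fun _ _ => cst 0)).
- by move=> i; exact: cst_continuous.
- by exists c.
move=> j; apply: (IH _ (fun=> 0) 0) => // i x Bx.
  by rewrite mulr_ge0 ?invr_ge0 ?(ltW (e0 i)) ?W0.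
by rewrite normr0 mul0r.
Qed.

Lemma tame_cst1 m (a : R) :
  tame v B (fun=> 1) m (fun _ _ => 1) (fun _ : I => cst a).
Proof. by apply: (@tame_cst _ _ _ (fun=> a) `|a|) => // i x _; rewrite mulr1. Qed.

Lemma tameD e m W f g : tame v B e m W f -> tame v B e m W g ->
  tame v B e m W (fun i x => f i x + g i x).
Proof.
elim: m W f g => [|m IH] W f g tf tg.
  have [cf [c [c0 bf]] _] := tf; have [cg [d [d0 bg]] _] := tg.
  split=> //; first by move=> i x; apply: cvgD; [exact: cf|exact: cg].
  exists (c + d); rewrite addr_ge0//; split=> // i x Bx.
  by rewrite mulrDl (le_trans (ler_normD _ _))// lerD ?bf ?bg.
have [cf [c [c0 bf]] df] := tf; have [cg [d [d0 bg]] dg] := tg.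
apply: (@tame_step _ _ _ _ (fun j i x => 'D_(v j) (f i) x + 'D_(v j) (g i) x)).
- by move=> i x; apply: cvgD; [exact: cf|exact: cg].
- exists (c + d); rewrite addr_ge0//; split=> // i x Bx.
  by rewrite mulrDl (le_trans (ler_normD _ _))// lerD ?bf ?bg.
- by move=> j i x; apply: is_deriveD; [exact: (tame_is_derive tf)|exact: (tame_is_derive tg)].
- by move=> j; apply: IH; [exact: (df j).2|exact: (dg j).2].
Qed.

(** Leibniz rule: in each of the two terms one factor is differentiated and takes the inverse scale
    with it, while the other is used at a lower order. *)
Lemma tameM e m W1 W2 f g : tame v B e m W1 f -> tame v B e m W2 g ->
  tame v B e m (fun i x => W1 i x * W2 i x) (fun i x => f i x * g i x).
Proof.
elim: m W1 W2 f g => [|m IH] W1 W2 f g tf tg;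
  have [cf [c [c0 bf]] df] := tf; have [cg [d [d0 bg]] dg] := tg;
  have cfg i : continuous (fun x => f i x * g i x)
    by [move=> x; apply: cvgM; [exact: cf|exact: cg]];
  have bfg : exists c, 0 <= c /\ forall i x, B x ->
      `|f i x * g i x| <= c * (W1 i x * W2 i x)
    by [exists (c * d); rewrite mulr_ge0//; split=> // i x Bx;
        rewrite mulrACA normrM ler_pM ?bf ?bg].
  by split.
apply: (@tame_step _ _ _ _ (fun j i x =>
  f i x * 'D_(v j) (g i) x + g i x * 'D_(v j) (f i) x)) => //.
  by move=> j i x; apply: is_deriveM; [exact: (tame_is_derive tf)|exact: (tame_is_derive tg)].
move=> j; apply: tameD.
  rewrite (_ : (fun i x => _) = (fun i x => W1 i x * ((e i)^-1 * W2 i x))).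
    by apply: IH; [exact: tameS|exact: (dg j).2].
  by apply/funext => i; apply/funext => x; rewrite mulrCA.
rewrite (_ : (fun i x => _) = (fun i x => W2 i x * ((e i)^-1 * W1 i x))).
  by apply: IH; [exact: tameS|exact: (df j).2].
by apply/funext => i; apply/funext => x; rewrite [RHS]mulrCA [W2 _ _ * _]mulrC.
Qed.

Lemma tame_scale e m W f (a : R) : (forall i, 0 < e i <= 1) ->
  tame v B e m W f -> tame v B e m W (fun i x => a * f i x).
Proof.
move=> e1 tf.
have := @tameM e m (fun _ _ => 1) W (fun=> cst a) f.
under [in X in _ -> _ -> X]eq_fun do under eq_fun do rewrite mul1r.
apply=> //.
apply: (@le_tame (fun=> 1) _ _ (fun _ _ => 1)) (tame_cst1 m a) => //.
by move=> i x _; rewrite ler01 lexx.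
Qed.

Lemma tameN e m W f : (forall i, 0 < e i <= 1) ->
  tame v B e m W f -> tame v B e m W (fun i x => - f i x).
Proof.
move=> e1 tf; rewrite (_ : (fun i x => _) = (fun i x => -1 * f i x)).
  exact: tame_scale.
by apply/funext => i; apply/funext => x; rewrite mulN1r.
Qed.

Lemma tame_prod e m (A : finType) (W f : A -> I -> V -> R) :
  (forall i, 0 < e i <= 1) ->
  (forall a, tame v B e m (W a) (f a)) ->
  tame v B e m (fun i x => \prod_a W a i x) (fun i x => \prod_a f a i x).
Proof.
move=> e1 tf; rewrite /index_enum; elim: (Finite.enum A) => [|a s IH].
  under [X in tame _ _ _ _ X _]eq_fun do under eq_fun do rewrite big_nil.
  under [X in tame _ _ _ _ _ X]eq_fun do under eq_fun do rewrite big_nil.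
  (* The empty product is constant and tame at scale 1; [e i <= 1] carries it to the scale [e]. *)
  apply: (@le_tame (fun=> 1) _ _ (fun _ _ => 1)) (tame_cst1 m 1) => //.
  by move=> i x _; rewrite ler01 lexx.
under [X in tame _ _ _ _ X _]eq_fun do under eq_fun do rewrite big_cons.
under [X in tame _ _ _ _ _ X]eq_fun do under eq_fun do rewrite big_cons.
exact: tameM.
Qed.

(** The derivative is [- f^-1 * f^-1 * f'], where [f^-1] is needed to one order less, so induction
    and the product rule apply. At scale and weight 1 all weights multiply to 1. *)
Lemma tameV m f : (forall i x, 1 <= f i x) ->
  tame v B (fun=> 1) m (fun _ _ => 1) f ->
  tame v B (fun=> 1) m (fun _ _ => 1) (fun i x => (f i x)^-1).
Proof.
move=> f1; have f0 i x : f i x != 0 by rewrite gt_eqF// (lt_le_trans ltr01).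
have W1 : (fun (i : I) (x : V) => 1^-1 * 1) = (fun _ _ => 1) :> (I -> V -> R).
  by apply/funext => i; apply/funext => x; rewrite invr1 mulr1.
have bf : exists c, 0 <= c /\ forall i x, B x -> `|(f i x)^-1| <= c * (1 : R).
  exists 1; split=> // i x _; rewrite mulr1 normfV invf_le1//.
    by rewrite (le_trans (f1 i x))// ler_norm.
  by rewrite normr_gt0.
elim: m => [|m IH] tf; have [cf _ df] := tf;
  have cV i : continuous (fun x => (f i x)^-1)
    by [move=> x; apply: cvgV; [exact: f0|exact: cf]].
  by split.
apply: (@tame_step _ _ _ _ (fun j i x => - ((f i x)^-1 * (f i x)^-1 * 'D_(v j) (f i) x))) => //.
  move=> j i x; apply: DeriveDef.
    by apply: derivableV => //; exact: (df j).1.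
  rewrite deriveV//; last exact: (df j).1.
  by rewrite /GRing.scale/= expr2 invfM mulNr.
move=> j; apply: tameN; first by move=> i; rewrite ltr01 lexx.
have IHf := IH (tameS tf).
have := (df j).2; rewrite W1 => tdf.
have := tameM (tameM IHf IHf) tdf.
by under [X in tame _ _ _ _ X _ -> _]eq_fun do under eq_fun do rewrite !mulr1.
Qed.

(** Chain rule by induction on the order. The inner functions are controlled only through their
    derivatives, the first being of size [1 / e]; the weight [W (f i x)] remembers where [h] and its
    derivatives live. *)
Lemma tame_comp e m (W h : R -> R) f :
  tame (fun _ : unit => 1 : R) setT (fun _ : unit => 1) m (fun=> W) (fun=> h) ->
  (forall i, continuous (f i)) ->
  (forall i x j, derivable (f i) x (v j)) ->
  (forall j, tame v B e m (fun i _ => (e i)^-1) (fun i => 'D_(v j) (f i))) ->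
  tame v B e m (fun i x => W (f i x)) (fun i x => h (f i x)).
Proof.
move=> + cf df; elim: m h => [|m IH] h th tdf; have [ch [c [c0 bh]] dh] := th;
  have chf i : continuous (h \o f i)
    by [move=> x; apply: continuous_comp; [exact: cf|exact: (ch tt)]];
  have bhf : exists c, 0 <= c /\ forall i x, B x -> `|h (f i x)| <= c * W (f i x)
    by [exists c; split=> // i x _; exact: (bh tt)].
  by split.
apply: (@tame_step _ _ _ _ (fun j i x => 'D_1 h (f i x) * 'D_(v j) (f i) x)) => //.
  by move=> j i x; apply: is_derive_comp1; apply: derivableP => //; exact: (dh tt).1 tt _.
move=> j.
have dht : tame v B e m (fun i x => W (f i x)) (fun i x => 'D_1 h (f i x)).
  apply: (IH ('D_1 h)); last by move=> j'; exact: tameS (tdf j').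
  have := (dh tt).2.
  by under [X in tame _ _ _ _ X _ -> _]eq_fun do under eq_fun do rewrite invr1 mul1r.
rewrite (_ : (fun i x => (e i)^-1 * _) = (fun i x => W (f i x) * (e i)^-1)).
  exact: tameM dht (tameS (tdf j)).
by apply/funext => i; apply/funext => x; rewrite mulrC.
Qed.

End TameTheory.

Lemma tame_reindex (R : realType) (V : normedModType R) (J I I' : Type) (v : J -> V)
    (B : set V) (e : I -> R) m (W f : I -> V -> R) (t : I' -> I) :
  tame v B e m W f -> tame v B (e \o t) m (W \o t) (f \o t).
Proof.
elim: m W f => [|m IH] W f [cf [c [c0 bf]] df].
  by split=> //; [move=> i; exact: cf|exists c; split=> // i; exact: bf].
split; [by move=> i; exact: cf|by exists c; split=> // i; exact: bf|].
by move=> j; split; [move=> i; exact: (df j).1|exact: IH _ _ (df j).2].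
Qed.

(** The summation index belongs to the index of the family, so one constant serves all terms. The
    triangle inequality then bounds the sum by the sum of the weights, whatever the number of
    terms. *)
Lemma tame_sum (R : realType) (V : normedModType R) (J I : Type) (v : J -> V)
    (B : set V) (e : I -> R) m (T : I -> finType) (P : forall i, pred (T i))
    (W f : {i : I & T i} -> V -> R) :
  tame v B (e \o tag) m W f ->
  tame v B e m (fun i x => \sum_(t | P i t) W (Tagged T t) x)
               (fun i x => \sum_(t | P i t) f (Tagged T t) x).
Proof.
elim: m W f => [|m IH] W f tf; have [cf [c [c0 bf]] df] := tf;
  have cS i : continuous (fun x => \sum_(t | P i t) f (Tagged T t) x)
    by [apply: continuous_big; [exact: add_continuous|move=> t _; exact: cf]];
  have bS : exists c, 0 <= c /\ forall i x, B x ->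
     `|\sum_(t | P i t) f (Tagged T t) x| <= c * (\sum_(t | P i t) W (Tagged T t) x)
    by [exists c; split=> // i x Bx; rewrite mulr_sumr (le_trans (ler_norm_sum _ _ _))//;
        apply: ler_sum => t _; exact: bf].
  by split.
apply: (@tame_step _ _ _ _ _ _ _ _ _ _
    (fun j i x => \sum_(t | P i t) 'D_(v j) (f (Tagged T t)) x)) => //.
  move=> j i x; rewrite /index_enum; elim: (Finite.enum (T i)) => [|t s IHs].
    apply: (@derive_ext _ _ (cst 0)); last by move=> y; rewrite big_nil.
    by rewrite big_nil; exact: is_derive_cst.
  rewrite big_cons; case: ifPn => Pt.
    apply: (@derive_ext _ _ (f (Tagged T t) + fun x => \sum_(t <- s | P i t) f (Tagged T t) x)).
      by apply: is_deriveD; exact: (tame_is_derive tf).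
    by move=> y; rewrite big_cons Pt.
  apply: derive_ext IHs _.
  by move=> y; rewrite big_cons (negbTE Pt).
move=> j; have := IH _ _ (df j).2.
by under [X in tame _ _ _ _ X _ -> _]eq_fun do under eq_fun do rewrite /= -mulr_sumr.
Qed.

(** * From tame families to iterated partial derivatives *)

Lemma tame_iter_partial (R : realType) (n : nat) (I : Type) (B : set 'rV[R]_n)
    (e : I -> R) m (W f : I -> 'rV[R]_n -> R) :
  (forall i, 0 <= e i) -> (forall i x, B x -> 0 <= W i x) ->
  tame (fun j : 'I_n => 'e_j) B e m W f ->
  exists c, 0 <= c /\ forall s : seq 'I_n, (size s <= m)%N -> forall i x, B x ->
    `|iter_partial (f i) s x| <= c * (e i ^- size s * W i x).
Proof.
move=> e0; elim: m W f => [|m IH] W f W0 [_ [c [c0 bf]] df].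
  by exists c; split=> // -[]//= _ i x Bx; rewrite expr0 invr1 mul1r bf.
have W0' i x : B x -> 0 <= (e i)^-1 * W i x.
  by move=> Bx; rewrite mulr_ge0 ?invr_ge0 ?W0.
have /choice[d dP] j := IH _ _ W0' (df j).2.
(* The sum over all directions dominates the constant of each first derivative, so the choice does
   not depend on [s]. *)
exists (c + \sum_j d j); split.
  by rewrite addr_ge0// sumr_ge0// => j _; have [] := dP j.
(* [foldr] applies the last index of [s] first, hence the induction from the right, which matches
   the recursion of [tame]. *)
elim/last_ind => [_ i x Bx|s j _].
  rewrite expr0 invr1 mul1r (le_trans (bf i x Bx))// ler_wpM2r ?W0//.
  by rewrite lerDl sumr_ge0// => j _; have [] := dP j.
rewrite size_rcons ltnS => sm i x Bx.
rewrite /iter_partial foldr_rcons; have [d0 dj] := dP j.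
apply: le_trans (dj s sm i x Bx) _.
rewrite exprSr invfM -[_ / _ * _]mulrA ler_wpM2r//.
  by rewrite mulr_ge0 ?W0'// invr_ge0 exprn_ge0.
rewrite (bigD1 j)//= addrCA lerDl addr_ge0// sumr_ge0// => j' _.
by have [] := dP j'.
Qed.

Lemma tame_smooth_on_Rn (R : realType) (n : nat) (I : Type) (B : set 'rV[R]_n)
    (e : I -> R) (W f : I -> 'rV[R]_n -> R) :
  (forall m, tame (fun j : 'I_n => 'e_j) B e m W f) ->
  forall i, smooth_on_Rn (f i).
Proof.
move=> tf i s; have := tf (size s).+1.
elim/last_ind: s W f {tf} => [|s j IH] W f.
  move=> [cf _ df]; split; first exact: cf.
  by move=> x j; exact: (df j).1.
rewrite size_rcons /iter_partial foldr_rcons => -[_ _ /(_ j)[_]].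
exact: IH.
Qed.

(** * A smooth partition of unity of the line *)

Section Tile.
Context {R : realType}.
Implicit Types (p : {poly R}) (t u : R).

(** Induction on [p] with [r] free: half of the exponent absorbs the smaller polynomial, the other
    half the new factor [u], by [1 + s <= expR s]. *)
Lemma poly_expR_bound p (r : R) : 0 < r ->
  exists C, 0 <= C /\ forall u, 0 <= u -> `|p.[u]| <= C * expR (r * u).
Proof.
elim/poly_ind: p r => [|p a IH] r r0.
  by exists 0; split=> // u _; rewrite horner0 normr0 mul0r.
have [C [C0 HC]] := IH (r / 2) ltac:(by rewrite divr_gt0).
exists (C * (2 / r) + `|a|); split.
  by rewrite addr_ge0// mulr_ge0// divr_ge0// ltW.
move=> u u0; rewrite hornerMXaddC (le_trans (ler_normD _ _))// mulrDl lerD//.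
  rewrite normrM (ger0_norm u0).
  have -> : expR (r * u) = expR (r / 2 * u) * expR (r / 2 * u).
    by rewrite -expRD -mulrDl -splitr.
  rewrite mulrACA; apply: ler_pM => //; first exact: HC.
  rewrite mulrC -ler_pdivrMr ?divr_gt0// invf_div mulrC.
  by apply: le_trans (expR_ge1Dx _); rewrite lerDr.
by rewrite ler_peMr// -expR0 ler_expR mulr_ge0 // ltW.
Qed.

(** The functions [p(1/t) exp(-1/t)], extended by 0, form a class stable under differentiation;
    bounds on all derivatives thus reduce to bounds on the class. *)
Definition flat p t : R := if 0 < t then p.[t^-1] * expR (- t^-1) else 0.

Lemma flat_bound p : exists C, 0 <= C /\ forall t, `|flat p t| <= C.
Proof.
have [C [C0 HC]] := poly_expR_bound p ltr01.
exists C; split=> // t; rewrite /flat; case: ifP => [t0|]; last by rewrite normr0.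
rewrite normrM (ger0_norm (expR_ge0 _)) expRN ler_pdivrMr ?expR_gt0//.
by rewrite -[X in expR X]mul1r HC// invr_ge0 ltW.
Qed.

Lemma flat_mulX p t : flat p t = t * flat ('X * p) t.
Proof.
rewrite /flat; case: ifP => t0; last by rewrite mulr0.
by rewrite hornerM hornerX !mulrA divff ?mul1r// gt_eqF.
Qed.

(** A factor [t] is extracted by trading [p] for ['X * p], so decay of any order at 0 follows from
    mere boundedness of the class. *)
Lemma flat_small p n : exists C, 0 <= C /\ forall t, `|flat p t| <= C * `|t| ^+ n.
Proof.
elim: n p => [|n IH] p.
  by have [C [C0 HC]] := flat_bound p; exists C; split=> // t; rewrite expr0 mulr1.
have [C [C0 HC]] := IH ('X * p); exists C; split=> // t.
by rewrite flat_mulX normrM mulrC exprSr mulrA ler_wpM2r.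
Qed.

Lemma is_derive_flat p t : is_derive t 1 (flat p) (flat ('X^2 * (p - p^`())) t).
Proof.
have [t0|t0|->] := ltrgt0P t.
- have tn0 : t != 0 by rewrite gt_eqF.
  have dV : is_derive t 1 (fun s : R => s^-1) (- (t^-1 ^+ 2)).
    apply: is_derive_eq; first by apply: is_deriveV.
    by rewrite /GRing.scale/= mulr1 exprVn.
  have dp : is_derive t 1 (horner p \o GRing.inv) (p^`().[t^-1] * - (t^-1 ^+ 2)).
    by apply: is_derive_comp1; exact: is_derive_poly.
  have de : is_derive t 1 (expR \o (fun s => - s^-1)) (expR (- t^-1) * t^-1 ^+ 2).
    rewrite -[t^-1 ^+ 2]opprK.
    by apply: is_derive_comp1; exact: is_deriveN.
  apply: (@near_eq_is_derive _ _ _ ((horner p \o GRing.inv) * (expR \o (fun s => - s^-1)))).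
    near=> s; rewrite /flat ifT//.
    by near: s; exact: lt_nbhsr.
  apply: is_derive_eq; rewrite /GRing.scale/= /flat t0.
  rewrite hornerM hornerXn hornerD hornerN; ring.
- apply: (@near_eq_is_derive _ _ _ (cst 0)).
    near=> s; rewrite /flat ifF//; apply/negbTE; rewrite -leNgt ltW//.
    by near: s; exact: lt_nbhsl.
  apply: is_derive_eq; rewrite /flat ifF//; apply/negbTE; rewrite -leNgt ltW//.
rewrite [X in is_derive _ _ _ X]/flat ltxx.
(* At 0 quadratic decay makes the difference quotient at most [C * |h|]. *)
have [C [C0 HC]] := flat_small p 2.
have : (fun h : R => h^-1 *: ((flat p \o shift 0) (h *: 1) - flat p 0)) @ 0^' --> (0:R).
  apply/cvgr0Pnorm_lt => e e0; near=> h.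
  rewrite /= addr0 [h *: 1]mulr1 [flat p 0]/flat ltxx subr0 /GRing.scale/= normrM.
  have h0 : 0 < `|h| by rewrite normr_gt0; near: h; exact: nbhs_dnbhs_neq.
  rewrite normfV mulrC ltr_pdivrMr// (le_lt_trans (HC h))// expr2 mulrA ltr_pM2r//.
  have hC : `|h| < e / (C + 1).
    near: h; apply: dnbhs0_lt; by rewrite divr_gt0// ltr_wpDl.
  rewrite (@le_lt_trans _ _ ((C + 1) * `|h|))//; first by rewrite ler_wpM2r// lerDl.
  by rewrite mulrC -ltr_pdivlMr// ltr_wpDl.
move=> cv; apply: DeriveDef; last exact: cvg_lim cv.
by apply/cvg_ex; exists 0.
Unshelve. all: by end_near. Qed.

Let dir1 := fun _ : unit => 1 : R.

Lemma tame_flat m p :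
  tame dir1 setT dir1 m (fun _ _ => 1) (fun=> flat p).
Proof.
have cf q : continuous (flat q).
  move=> t; apply/differentiable_continuous/derivable1_diffP.
  by have [] := is_derive_flat q t.
elim: m p => [|m IH] p; have [C [C0 HC]] := flat_bound p;
  have bf : exists c, 0 <= c /\ forall (i : unit) t, setT t -> `|flat p t| <= c * 1
    by [exists C; split=> // _ t _; rewrite mulr1].
  by split.
apply: (@tame_step _ _ _ _ _ _ _ _ _ _ (fun _ _ => flat ('X^2 * (p - p^`())))) => //.
  by move=> j i t; exact: is_derive_flat.
move=> _; under [X in tame _ _ _ _ X _]eq_fun do under eq_fun do rewrite invr1 mulr1.
exact: IH.
Qed.

(** The factor [expR 1] normalises the value at 1 to 1, so that [1 - ramp t] changes sign there. *)
Definition ramp t : R := flat (expR 1)%:P t.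

Lemma ramp_ge0 t : 0 <= ramp t.
Proof.
by rewrite /ramp /flat; case: ifP => // _; rewrite hornerC mulr_ge0 ?expR_ge0.
Qed.

Lemma ramp_le0 t : t <= 0 -> ramp t = 0.
Proof. by rewrite /ramp /flat ltNge => ->. Qed.

Lemma ramp_gt0E t : 0 < t -> ramp t = expR (1 - t^-1).
Proof. by move=> t0; rewrite /ramp /flat t0 hornerC expRD. Qed.

Lemma ramp_le1 t : t <= 1 -> ramp t <= 1.
Proof.
have [t0|t0 t1] := leP t 0; first by rewrite ramp_le0.
by rewrite ramp_gt0E// -[leRHS]expR0 ler_expR subr_le0 invf_ge1.
Qed.

Lemma ramp_ge1 t : 1 <= t -> 1 <= ramp t.
Proof.
move=> t1; have t0 : 0 < t by exact: lt_le_trans t1.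
by rewrite ramp_gt0E// -[leLHS]expR0 ler_expR subr_ge0 invf_le1.
Qed.

(* Composing [ramp] with itself avoids the usual quotient of bump functions: both
   plateaus come from [ramp] vanishing on the negative half-line. *)
Definition step_down t : R := ramp (1 - ramp t).

Lemma step_down_ge0 t : 0 <= step_down t. Proof. exact: ramp_ge0. Qed.

Lemma step_down_le1 t : step_down t <= 1.
Proof. by rewrite ramp_le1// gerBl ramp_ge0. Qed.

Lemma step_down_le0 t : t <= 0 -> step_down t = 1.
Proof.
by move=> t0; rewrite /step_down (ramp_le0 t0) subr0 ramp_gt0E// invr1 subrr expR0.
Qed.

Lemma step_down_ge1 t : 1 <= t -> step_down t = 0.
Proof. by move=> /ramp_ge1 t1; rewrite /step_down ramp_le0// subr_le0. Qed.

Lemma tame_step_down m : tame dir1 setT dir1 m (fun _ _ => 1) (fun=> step_down).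
Proof.
have t1 n : tame dir1 setT dir1 n (fun _ _ => 1) (fun _ t => 1 - ramp t).
  apply: tameD; first exact: tame_cst1.
  by apply: tameN; [move=> i; rewrite ltr01 lexx|exact: tame_flat].
have [_ _ d1] := t1 m.+1.
apply: (@tame_comp _ _ _ _ _ _ _ _ (fun=> 1) ramp (fun _ t => 1 - ramp t)).
- exact: tame_flat.
- exact: tame_cont (t1 0).
- by move=> i x j; exact: (d1 j).1.
- move=> j; have := (d1 j).2.
  by under [X in tame _ _ _ _ X _ -> _]eq_fun do under eq_fun do rewrite mulr1.
Qed.

(** A difference of two translates of one step: it vanishes outside [[-1, 1]], and its integer
    translates telescope. *)
Definition tile t : R := step_down t - step_down (t + 1).

Lemma tile_ge0 t : 0 <= tile t.
Proof.
have [t0|t0] := leP t 0.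
  by rewrite /tile step_down_le0// subr_ge0 step_down_le1.
by rewrite /tile (@step_down_ge1 (t + 1)) ?subr0 ?step_down_ge0// lerDr ltW.
Qed.

Lemma tile_out t : 1 < `|t| -> tile t = 0.
Proof.
rewrite lter_normr => /orP[t1|t1]; rewrite /tile.
  by rewrite !step_down_ge1 ?subrr//; lra.
by rewrite !step_down_le0 ?subrr//; lra.
Qed.

Lemma sum_tile (L : nat) t : 0 <= t -> t + 1 <= L%:R ->
  \sum_(m < L) tile (t - m%:R) = 1.
Proof.
move=> t0 tL; pose F m : R := step_down (t - m%:R + 1).
rewrite (eq_bigr (fun m : 'I_L => F m.+1 - F m)); last first.
  by move=> m _; rewrite /F /tile -natr1 opprD addrA subrK.
rewrite -(big_mkord xpredT (fun m => F m.+1 - F m)) telescope_sumr// /F.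
(* Here [F L = 1] because [t + 1 <= L], and [F 0 = 0] because [0 <= t]. *)
rewrite step_down_le0 ?step_down_ge1 ?subr0//; lra.
Qed.

(** Used as a weight that records supports: few integer translates are nonzero at one point, so sums
    of these weights stay bounded however fine the grid. *)
Definition indic1 t : R := (`|t| <= 1)%R%:R.

Lemma sum_indic1 (L : nat) t : \sum_(m < L) indic1 (t - m%:R) <= 3.
Proof.
(* A telescoping majorant: [clamp] has slope 1 on [0, 3]. *)
pose clamp (s : R) := if s <= 0 then 0 else if s <= 3 then s else 3.
pose F m : R := - clamp (t - m%:R + 2).
apply: (@le_trans _ _ (\sum_(m < L) (F m.+1 - F m))).
  apply: ler_sum => m _; rewrite /F -natr1.
  have -> : t - (m%:R + 1) + 2 = t - m%:R + 1 by ring.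
  move: (t - m%:R) => s; rewrite opprK addrC /clamp /indic1 ler_norml.
  have [?|?] := leP (-1) s; have [?|?] := leP s 1; rewrite /=;
  have [?|?] := leP (s + 2) 0; have [?|?] := leP (s + 2) 3;
  have [?|?] := leP (s + 1) 0; have [?|?] := leP (s + 1) 3; lra.
rewrite -(big_mkord xpredT (fun m => F m.+1 - F m)) telescope_sumr// /F opprK.
move: (t - _ + _) (t - _ + _) => a b; rewrite /clamp.
by case: ifP => ?; case: ifP => ?; try case: ifP => ?; try case: ifP => ?; lra.
Qed.

(** On the open set [1 < |t|] the function is locally zero, so its derivatives vanish there too and
    the weight passes to every order. *)
Lemma tame_support m (f : R -> R) :
  tame dir1 setT dir1 m (fun _ _ => 1) (fun=> f) ->
  (forall t, 1 < `|t| -> f t = 0) ->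
  tame dir1 setT dir1 m (fun _ t => indic1 t) (fun=> f).
Proof.
elim: m f => [|m IH] f tf f0; have [cf [c [c0 bf]] df] := tf;
  have bf' : exists c, 0 <= c /\ forall (i : unit) t, setT t ->
      `|f t| <= c * indic1 t
    by [exists c; split=> // i t _; rewrite /indic1; case: (leP `|t| 1) => t1;
        [exact: (bf tt t)|rewrite (f0 t t1) normr0 mulr0]].
  by split.
split=> // j; split; first exact: (df j).1.
under [X in tame _ _ _ _ X _]eq_fun do under eq_fun do rewrite invr1 mul1r.
apply: IH.
  have := (df j).2.
  by under [X in tame _ _ _ _ X _ -> _]eq_fun do under eq_fun do rewrite invr1 mul1r.
move=> t t1; rewrite (@near_eq_derive _ _ _ _ (cst 0)) ?derive_cst//.
near=> s; apply: f0; near: s.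
have : (fun s : R => `|s|) @ t --> `|t| by apply: cvg_norm; exact: cvg_id.
by move/cvgr_gt; exact.
Unshelve. all: by end_near. Qed.

Lemma tame_tile m :
  tame dir1 setT dir1 m (fun _ t => indic1 t) (fun=> tile).
Proof.
apply: tame_support; last exact: tile_out.
have e1 : forall i, 0 < dir1 i <= 1 by move=> i; rewrite ltr01 lexx.
apply: tameD; first exact: tame_step_down.
apply: tameN => //.
have dS (i : unit) (x : R) (j : unit) : is_derive x (dir1 j) (fun t : R => t + 1) 1.
  by apply: is_derive_eq; rewrite addr0.
apply: (@tame_comp _ _ _ _ _ _ _ _ (fun=> 1) step_down (fun _ t => t + 1)).
- exact: tame_step_down.
- move=> _ t; apply: cvgD; [exact: cvg_id|exact: cvg_cst].
- by move=> i x j; have [] := dS i x j.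
- move=> j; rewrite (_ : (fun i : unit => 'D_(dir1 j) (fun t : R => t + 1)) = fun=> cst 1).
    rewrite (_ : (fun i _ => (dir1 i)^-1) = fun _ _ => 1); first exact: tame_cst1.
    by apply/funext => i; apply/funext => x; rewrite invr1.
  by apply/funext => i; apply/funext => x; have [_ ->] := dS i x j.
Qed.

End Tile.

(** * Upper bound for the Fubini-Study distance *)

Section HermitianCoordinates.
Context {R : realType}.
Local Notation Re := complex.Re.
Local Notation Im := complex.Im.

Definition sqn n (z : 'rV[R[i]]_n) : R :=
  \sum_l (Re (z 0 l) ^+ 2 + Im (z 0 l) ^+ 2).

(** Real part (flag [false]) or imaginary part (flag [true]) of [u] times the conjugate of [w], an
    entry of the matrix [z z^*]. *)
Definition herm n (a : bool * 'I_n * 'I_n) (z : 'rV[R[i]]_n) : R :=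
  let u := z 0 a.1.2 in let w := z 0 a.2 in
  if a.1.1 then Im u * Re w - Re u * Im w else Re u * Re w + Im u * Im w.

Lemma sqn_ge n (z : 'rV[R[i]]_n) l : Re (z 0 l) ^+ 2 + Im (z 0 l) ^+ 2 <= sqn z.
Proof.
rewrite /sqn (bigD1 l)//= lerDl sumr_ge0// => i _.
by rewrite addr_ge0// sqr_ge0.
Qed.

Lemma sqn_ge0 n (z : 'rV[R[i]]_n) : 0 <= sqn z.
Proof. by rewrite sumr_ge0// => i _; rewrite addr_ge0// sqr_ge0. Qed.

Lemma sqn_eq0 n (z : 'rV[R[i]]_n) : (sqn z == 0) = (z == 0).
Proof.
apply/eqP/eqP => [z0|->]; last first.
  by rewrite /sqn big1// => l _; rewrite mxE/= expr0n addr0.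
apply/rowP => l; rewrite mxE; have := sqn_ge z l; rewrite z0.
case: (z 0 l) => a b /= ab; have [a0 b0] : a = 0 /\ b = 0.
  have := sqr_ge0 a; have := sqr_ge0 b => ha hb.
  by split; apply/eqP; rewrite -sqrf_eq0 eq_le; apply/andP; split=> //; lra.
by rewrite a0 b0.
Qed.

Lemma sqn_gt0 n (z : 'rV[R[i]]_n) : (0 < sqn z) = (z != 0).
Proof. by rewrite lt_def sqn_eq0 sqn_ge0 andbT. Qed.

Lemma norm_herm_le n a (z : 'rV[R[i]]_n) : `|herm a z| <= sqn z.
Proof.
have := sqn_ge z a.1.2; have := sqn_ge z a.2; rewrite /herm.
move: (Re _) (Im _) (Re _) (Im _) (sqn z) => c d u w S h1 h2.
have := sqr_ge0 (u - c); have := sqr_ge0 (u + c); have := sqr_ge0 (w - d);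
have := sqr_ge0 (w + d); have := sqr_ge0 (w - c); have := sqr_ge0 (w + c);
have := sqr_ge0 (u - d); have := sqr_ge0 (u + d).
rewrite ler_norml => *.
by case: a.1.1; apply/andP; split; lra.
Qed.

Lemma sqnZ n c (z : 'rV[R[i]]_n) : sqn (c *: z) = (Re c ^+ 2 + Im c ^+ 2) * sqn z.
Proof.
rewrite /sqn mulr_sumr; apply: eq_bigr => l _; rewrite mxE.
case: c (z 0 l) => [a b] [c d] /=; ring.
Qed.

Lemma sqnN n (z : 'rV[R[i]]_n) : sqn (- z) = sqn z.
Proof. by rewrite -scaleN1r sqnZ /= oppr0 sqrrN expr1n expr0n addr0 mul1r. Qed.

Lemma hermZ n a c (z : 'rV[R[i]]_n) :
  herm a (c *: z) = (Re c ^+ 2 + Im c ^+ 2) * herm a z.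
Proof.
rewrite /herm !mxE.
by case: c (z 0 a.1.2) (z 0 a.2) a.1.1 => [a1 b1] [c d] [u w] [] /=; ring.
Qed.

Lemma hdot_self k (z : 'rV[R[i]]_k.+1) : hdot z z = ((sqn z)%:C)%C.
Proof.
rewrite /hdot /sqn rmorph_sum; apply: eq_bigr => l _.
case: (z 0 l) => a b; apply/eqP; rewrite eq_complex/=.
by apply/andP; split; apply/eqP; ring.
Qed.

Lemma hdot_conj k (z w : 'rV[R[i]]_k.+1) : hdot w z = ((hdot z w)^*)%C.
Proof.
rewrite /hdot rmorph_sum; apply: eq_bigr => l _.
case: (z 0 l) (w 0 l) => [a b] [c d]; apply/eqP; rewrite eq_complex/=.
by apply/andP; split; apply/eqP; ring.
Qed.

(** Dropping the squared modulus of [hdot z v] from the numerator leaves [sqn v / sqn z] under the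
    root. *)
Lemma fs_norm_le k (z v : 'rV[R[i]]_k.+1) (c : R) : 0 <= c -> z != 0 ->
  sqn v <= c ^+ 2 * sqn z -> fs_norm z v <= c.
Proof.
move=> c0; rewrite -sqn_gt0 => z0 vz.
rewrite /fs_norm (hdot_conj z v) !hdot_self.
case: (hdot z v) => a b.
have -> : Re (((sqn z)%:C * (sqn v)%:C - (a +i* b)^* * (a +i* b)) / (sqn z)%:C ^+ 2)%C =
   (sqn z * sqn v - (a ^+ 2 + b ^+ 2)) / sqn z ^+ 2.
  rewrite -rmorphM -rmorphXn.
  have -> : ((a +i* b)^* * (a +i* b) = (a ^+ 2 + b ^+ 2)%:C)%C.
    by apply/eqP; rewrite eq_complex/=; apply/andP; split; apply/eqP; ring.
  by rewrite -rmorphB -fmorphV -rmorphM.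
rewrite -[leRHS](ger0_norm c0) -sqrtr_sqr ler_wsqrtr//.
rewrite ler_pdivrMr ?exprn_gt0//.
apply: (@le_trans _ _ (sqn z * sqn v)); first by rewrite gerBl addr_ge0// sqr_ge0.
by rewrite expr2 mulrCA ler_pM2l// mulrC.
Qed.

Definition to_real_coords n (z : 'rV[R[i]]_n) : 'rV[R]_(n + n) :=
  row_mx (\row_j Re (z 0 j)) (\row_j Im (z 0 j)).

Lemma to_real_coordsK n : cancel (@to_real_coords n) (@of_real_coords R n).
Proof.
move=> z; apply/rowP => l; rewrite mxE row_mxEl row_mxEr !mxE.
by case: (z 0 l).
Qed.

Lemma to_real_coordsN n (z : 'rV[R[i]]_n) : to_real_coords (- z) = - to_real_coords z.
Proof.
apply/rowP => i; rewrite !mxE.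
by case: (fintype.split i) => j; rewrite !mxE; case: (z 0 j).
Qed.

Lemma of_real_coordsDZ n (x y : 'rV[R]_(n + n)) (t : R) :
  of_real_coords (x + t *: y) = of_real_coords x + (t%:C)%C *: of_real_coords y.
Proof.
apply/rowP => l; rewrite !mxE; apply/eqP; rewrite eq_complex/=.
by apply/andP; split; apply/eqP; ring.
Qed.

(** In each real coordinate [(a - t c)^2 - a^2 / 2 + t^2 c^2] is the square [(a - 2 t c)^2 / 2], and
    [t^2 <= 1]. *)
Lemma sqn_segment n (z v : 'rV[R[i]]_n) (t : R) : 0 <= t <= 1 ->
  sqn z / 2 - sqn v <= sqn (z - (t%:C)%C *: v).
Proof.
move=> /andP[t0 t1]; rewrite /sqn mulr_suml -sumrB; apply: ler_sum => l _.
rewrite !mxE; case: (z 0 l) (v 0 l) => [a b] [c d] /=.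
rewrite !(mul0r, subr0, addr0).
have tt : t ^+ 2 <= 1 by rewrite expr_le1.
have := ler_wpM2r (sqr_ge0 c) tt; have := ler_wpM2r (sqr_ge0 d) tt.
have := sqr_ge0 (a - 2 * (t * c)); have := sqr_ge0 (b - 2 * (t * d)).
rewrite !mul1r => *; lra.
Qed.

End HermitianCoordinates.

(** * Coordinates of the projection onto a line, and their control of the distance *)

Section ProjectiveCoordinates.
Context {R : realType} {k : nat}.
Local Notation Re := complex.Re.
Local Notation Im := complex.Im.
Implicit Types (x y : cproj R k) (a : bool * 'I_k.+1 * 'I_k.+1).

Definition rep x : 'rV[R[i]]_k.+1 := vpick (sval x).

Lemma rep_neq0 x : rep x != 0.
Proof.
rewrite vpick0; apply/eqP => x0; have := svalP x.
by rewrite x0 dimv0.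
Qed.

Lemma line_rep x : <[rep x]>%VS = sval x.
Proof.
apply/eqP; rewrite eqEdim -memvE memv_pick dim_vline rep_neq0.
by rewrite (eqP (svalP x)).
Qed.

(* Real and imaginary parts of the entries of the orthogonal projection onto
   the line [x]. *)
Definition proj_coord a x : R := herm a (rep x) / sqn (rep x).

(** Rescaling the spanning vector by [c] multiplies numerator and denominator by the same
    [|c|^2]. *)
Lemma proj_coordE a x z : sval x = <[z]>%VS -> proj_coord a x = herm a z / sqn z.
Proof.
move=> xz; have /vlineP[c cz] : rep x \in <[z]>%VS by rewrite -xz memv_pick.
have := rep_neq0 x; rewrite -sqn_gt0 /proj_coord cz hermZ sqnZ => czp.
rewrite -mulf_div divff ?mul1r//.
by apply: contraTneq czp => ->; rewrite mul0r ltxx.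
Qed.

Lemma norm_proj_coord_le a x : `|proj_coord a x| <= 1.
Proof.
have := rep_neq0 x; rewrite -sqn_gt0 => r0.
by rewrite normrM normfV (gtr0_norm r0) ler_pdivrMr// mul1r norm_herm_le.
Qed.

(** The integral of a nonnegative function is a supremum over the simple functions below it, and
    these lie below the constant too; measurability of the Fubini-Study speed thus never comes
    up. *)
Lemma ge0_integral_le_cst (f : R -> R) (c : R) : (forall t, 0 <= f t) ->
  (forall t, 0 <= t <= 1 -> f t <= c) ->
  (\int[lebesgue_measure]_(t in `[0%R, 1%R]) (f t)%:E <= c%:E)%E.
Proof.
move=> f0 fc.
have -> : c%:E = (\int[lebesgue_measure]_(t in `[0%R, 1%R]) (cst c%:E t))%E :> \bar R.
  rewrite integral_cst//= lebesgue_measure_itv/= lte_fin ltr01.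
  by rewrite -EFinB subr0 mule1.
have c0 : 0 <= c by apply: le_trans (f0 0) (fc 0 _); rewrite lexx ler01.
rewrite !ge0_integralE//.
- apply: ge_ereal_sup => _ [h hf <-]; apply: ereal_sup_ubound; exists h => // t.
  apply: le_trans (hf t) _; rewrite /patch; case: ifPn => // /set_mem/= t01.
  by rewrite lee_fin fc//; move: t01; rewrite in_itv.
- by move=> t _; rewrite lee_fin.
Qed.

(* The path runs from [z] to its projection onto [y], which differs from [z] by
   the image of [z] under the difference of the two projections. *)
Lemma fs_dist_le x y (eta : R) : 0 <= eta ->
  (forall a, `|proj_coord a x - proj_coord a y| <= eta) ->
  6 * k.+1%:R ^+ 2 * eta <= 1 ->
  (fs_dist x y <= (6 * k.+1%:R ^+ 2 * eta)%:E)%E.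
Proof.
set n : R := k.+1%:R; set c := 6 * n ^+ 2 * eta => eta0 xy c1.
have n1 : 1 <= n by rewrite ler1n.
have c0 : 0 <= c by rewrite /c !mulr_ge0// exprn_ge0// (le_trans ler01).
set z := rep x; set w := rep y.
have z0 : 0 < sqn z by rewrite sqn_gt0 rep_neq0.
have w0 : 0 < sqn w by rewrite sqn_gt0 rep_neq0.
(* [H u] is the matrix of the orthogonal projection onto the line of [u]. *)
pose H (u : 'rV[R[i]]_k.+1) l p : R[i] := u 0 l * ((u 0 p)^*)%C / ((sqn u)%:C)%C.
have HE u l p : H u l p =
    ((herm (false, l, p) u / sqn u) +i* (herm (true, l, p) u / sqn u))%C.
  rewrite /H -fmorphV /herm/=; case: (u 0 l) (u 0 p) => [? ?] [? ?] /=.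
  by apply/eqP; rewrite eq_complex/=; apply/andP; split; apply/eqP; ring.
(* As [H z] fixes [z], [v] is [z] minus its projection [lam *: w] onto [y]. *)
pose v : 'rV[R[i]]_k.+1 := \row_l \sum_p (H z l p - H w l p) * z 0 p.
pose lam : R[i] := (\sum_p ((w 0 p)^*)%C * z 0 p) / ((sqn w)%:C)%C.
have zvw : z - v = lam *: w.
  apply/rowP => l; rewrite !mxE.
  have -> : \sum_p (H z l p - H w l p) * z 0 p =
      \sum_p H z l p * z 0 p - \sum_p H w l p * z 0 p.
    by rewrite -sumrB; apply: eq_bigr => p _; rewrite mulrBl.
  have -> : \sum_p H z l p * z 0 p = z 0 l.
    transitivity (z 0 l * (hdot z z / ((sqn z)%:C)%C)).
      rewrite /hdot mulr_suml mulr_sumr; apply: eq_bigr => p _.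
      by rewrite /H; ring.
    by rewrite hdot_self divff ?mulr1// fmorph_eq0 gt_eqF.
  rewrite opprB addrCA subrr addr0 /lam !mulr_suml; apply: eq_bigr => p _.
  by rewrite /H; ring.
have sz l : `|Re (z 0 l)| <= Num.sqrt (sqn z) /\ `|Im (z 0 l)| <= Num.sqrt (sqn z).
  have := sqn_ge z l; rewrite -!sqrtr_sqr => h.
  by split; rewrite ler_wsqrtr// (le_trans _ h)// ?lerDl ?lerDr sqr_ge0.
have bv l : `|Re (v 0 l)| <= 2 * eta * n * Num.sqrt (sqn z) /\
            `|Im (v 0 l)| <= 2 * eta * n * Num.sqrt (sqn z).
  have bnd (G : 'I_k.+1 -> R) (s t : 'I_k.+1 -> R) :
      (forall p, `|G p| <= 2 * eta * Num.sqrt (sqn z)) ->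
      `|\sum_p G p| <= 2 * eta * n * Num.sqrt (sqn z).
    move=> hG; apply: le_trans (ler_norm_sum _ _ _) _.
    apply: le_trans (ler_sum _ (fun p _ => hG p)) _.
    rewrite sumr_const card_ord -mulr_natl /n; rewrite le_eqVlt; apply/orP; left; apply/eqP; ring.
  have ReE : Re (v 0 l) = \sum_p Re ((H z l p - H w l p) * z 0 p).
    rewrite /v mxE; elim/big_rec2: _ => //= p u1 u2 _ <-; by case: (_ * _) u2 => [? ?] [? ?].
  have ImE : Im (v 0 l) = \sum_p Im ((H z l p - H w l p) * z 0 p).
    rewrite /v mxE; elim/big_rec2: _ => //= p u1 u2 _ <-; by case: (_ * _) u2 => [? ?] [? ?].
  rewrite ReE ImE; split; apply: bnd => // p; rewrite !HE.
    have := xy (false, l, p); have := xy (true, l, p); rewrite /proj_coord -/z -/w.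
    move: (herm _ _ / _) (herm _ _ / _) (herm _ _ / _) (herm _ _ / _) => h1 h2 h3 h4.
    have [] := sz p; case: (z 0 p) => a b /= za zb i1 i2.
    apply: le_trans (ler_normB _ _) _; rewrite !normrM -mulrA mulr2n mulrDl mul1r.
    by apply: lerD; apply: ler_pM.
  have := xy (false, l, p); have := xy (true, l, p); rewrite /proj_coord -/z -/w.
  move: (herm _ _ / _) (herm _ _ / _) (herm _ _ / _) (herm _ _ / _) => h1 h2 h3 h4.
  have [] := sz p; case: (z 0 p) => a b /= za zb i1 i2.
  apply: le_trans (ler_normD _ _) _; rewrite !normrM -mulrA mulr2n mulrDl mul1r.
  by apply: lerD; apply: ler_pM.
(* Each of the [n] coordinates contributes at most [8 eta^2 n^2 |z|^2]. The total
   [8 n^3 eta^2 |z|^2] is below [9 n^4 eta^2 |z|^2], which is [c^2 / 4 * |z|^2]: hence the 6 in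
   [c]. *)
have vz : sqn v <= c ^+ 2 / 4 * sqn z.
  have : sqn v <= \sum_(l < k.+1) (8 * eta ^+ 2 * n ^+ 2 * sqn z).
    apply: ler_sum => l _; have [h1 h2] := bv l.
    have sq (r : R) : `|r| <= 2 * eta * n * Num.sqrt (sqn z) ->
        r ^+ 2 <= 4 * eta ^+ 2 * n ^+ 2 * sqn z.
      move=> hr; rewrite -real_normK ?num_real//.
      apply: le_trans (_ : (2 * eta * n * Num.sqrt (sqn z)) ^+ 2 <= _).
        by rewrite ler_pXn2r// nnegrE// (le_trans _ hr).
      rewrite !exprMn sqr_sqrtr ?sqn_ge0//; rewrite le_eqVlt; apply/orP; left; apply/eqP; ring.
    apply: le_trans (lerD (sq _ h1) (sq _ h2)) _.
    by rewrite le_eqVlt; apply/orP; left; apply/eqP; ring.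
  rewrite sumr_const card_ord -[_ *+ k.+1]mulr_natl -/n => /le_trans; apply.
  have -> : c ^+ 2 / 4 * sqn z = 9 * n * (n * n ^+ 2 * eta ^+ 2 * sqn z).
    by rewrite /c; field.
  set S := sqn z; have -> : n * (8 * eta ^+ 2 * n ^+ 2 * S) =
    8 * (n * n ^+ 2 * eta ^+ 2 * S) by ring.
  apply: ler_wpM2r; last lra.
  by rewrite !mulr_ge0 ?exprn_ge0 ?sqn_ge0// (le_trans ler01).
have c2 : c ^+ 2 <= 1 by rewrite expr_le1.
(* Since [c <= 1], at least [1/2 - 1/4] of [|z|^2] survives along the path; against
   [|v|^2 <= c^2 / 4 * |z|^2] this gives speed at most [c]. *)
have zt t : 0 <= t <= 1 -> sqn z / 4 <= sqn (z - (t%:C)%C *: v).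
  move=> t01; apply: le_trans (sqn_segment z v t01).
  have := ler_wpM2r (ltW z0) c2; move: vz; rewrite mulrAC mul1r; lra.
pose path (t : R) : 'rV[R]_(k.+1 + k.+1) := to_real_coords z + t *: - to_real_coords v.
have pathE t : of_real_coords (path t) = z - (t%:C)%C *: v.
  rewrite of_real_coordsDZ to_real_coordsK -scalerN; congr (_ + _ *: _).
  by rewrite -to_real_coordsN to_real_coordsK.
have zt0 t : 0 <= t <= 1 -> of_real_coords (path t) != 0.
  by move=> t01; rewrite pathE -sqn_gt0 (lt_le_trans _ (zt t t01))// divr_gt0.
have dpath (t : R) : is_derive t (1 : R) path (- to_real_coords v).
  rewrite -[X in is_derive _ _ _ X]add0r; apply: is_deriveD.
  have sdiff : is_diff t (fun s : R => s *: - to_real_coords v)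
    (fun s : R => s *: - to_real_coords v) by exact: is_diff_scalel.
  apply: DeriveDef; first exact: diff_derivable.
  by rewrite deriveE// diff_val scale1r.
have d1path : derive1 path = cst (- to_real_coords v).
  by apply/funext => t; rewrite derive1E; have [_ ->] := dpath t.
apply: le_trans (_ : (fs_length path <= _)%E).
  apply: ereal_inf_lbound; exists path => //; split => //.
  - by split=> [t|]; [have [] := dpath t|rewrite d1path => t; exact: cvg_cst].
  - by rewrite pathE scale0r subr0 line_rep.
  (* The endpoint [lam *: w] is nonzero, so [lam] is invertible and the endpoint spans the line
     [y]. *)
  - have := zt0 1; rewrite pathE scale1r zvw ler01 lexx => /(_ isT) lw0.
    have lam0 : lam != 0 by apply: contraNneq lw0 => ->; rewrite scale0r.
    rewrite -(line_rep y); apply/eqP; rewrite eqEsubv -!memvE memvZ ?memv_line//=.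
    by rewrite -[X in X \in _](scalerK lam0) memvZ ?memv_line.
apply: ge0_integral_le_cst => [t|t t01]; first exact: sqrtr_ge0.
have dE : of_real_coords (derive1 path t) = - v.
  by rewrite d1path -to_real_coordsN to_real_coordsK.
rewrite dE pathE; apply: fs_norm_le => //; first by rewrite -pathE zt0.
rewrite sqnN (le_trans vz)// -mulrA ler_wpM2l ?exprn_ge0//.
by rewrite mulrC zt.
Qed.

End ProjectiveCoordinates.

(** * Cutoff functions on P^k *)

Section Charts.
Context {R : realType} {k : nat}.
Local Notation Re := complex.Re.
Local Notation Im := complex.Im.
Local Notation chart_tame m f :=
  (tame (fun i : 'I_(k + k) => 'e_i) (@closed_polydisc R k) (fun _ : unit => 1) m
     (fun _ _ => 1) (fun=> f)).

Lemma chart_tameM m (f g : 'rV[R]_(k + k) -> R) :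
  chart_tame m f -> chart_tame m g -> chart_tame m (fun x => f x * g x).
Proof.
move=> tf tg; have := tameM tf tg.
by under [X in tame _ _ _ _ X _ -> _]eq_fun do under eq_fun do rewrite mulr1.
Qed.

Lemma chart_tame_cst m (c : R) : chart_tame m (cst c).
Proof. exact: tame_cst1. Qed.

Lemma chart_tameB m (f g : 'rV[R]_(k + k) -> R) :
  chart_tame m f -> chart_tame m g -> chart_tame m (fun x => f x - g x).
Proof.
by move=> tf tg; apply: tameD => //; apply: tameN => // i; rewrite ltr01 lexx.
Qed.

Lemma chart_tame_sum m (A : finType) (f : A -> 'rV[R]_(k + k) -> R) :
  (forall a, chart_tame m (f a)) -> chart_tame m (fun x => \sum_a f a x).
Proof.
move=> tf; rewrite /index_enum; elim: (Finite.enum A) => [|a s IH].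
  by under [X in tame _ _ _ _ _ X]eq_fun do under eq_fun do rewrite big_nil;
    exact: chart_tame_cst.
under [X in tame _ _ _ _ _ X]eq_fun do under eq_fun do rewrite big_cons.
by apply: tameD; first exact: tf.
Qed.

Lemma is_derive_coord (n : nat) (x v : 'rV[R]_n) (p : 'I_n) :
  is_derive x v (fun y : 'rV[R]_n => y 0 p) (v 0 p).
Proof.
have /derivable_mxP d : derivable (@id 'rV[R]_n) x v by exact: derivable_id.
apply: DeriveDef; first exact: d.
have := derive_mx (@derivable_id _ _ x v).
by rewrite derive_id => /rowP /(_ p); rewrite mxE.
Qed.

Lemma chart_tame_coord m p : chart_tame m (fun x => x 0 p).
Proof.
have bc : exists c : R, 0 <= c /\ forall (i : unit) x, @closed_polydisc R k x ->
    `|x 0 p| <= c * 1.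
  (* Coordinates are unbounded on the chart; on the closed polydisc real and imaginary parts are
     dominated by a modulus at most 1. *)
  exists 1; split=> // _ x Bx; rewrite mulr1.
  rewrite -[p]splitK; case: (fintype.split p) => q; have := Bx q;
    rewrite mxE normc_def lecR => h; apply: le_trans h;
    by rewrite -[leLHS]sqrtr_sqr ler_wsqrtr//= ?lerDl ?lerDr sqr_ge0.
case: m => [|m]; first by split=> // _; exact: coord_continuous.
apply: (@tame_step _ _ _ _ _ _ _ _ _ _ (fun j _ => cst (('e_j : 'rV[R]_(k + k)) 0 p))) => //.
- by move=> _; exact: coord_continuous.
- by move=> j i x; exact: is_derive_coord.
move=> j; under [X in tame _ _ _ _ X _]eq_fun do under eq_fun do rewrite invr1 mulr1.
exact: chart_tame_cst.
Qed.

Lemma chart_tame_affine_vec m (j l : 'I_k.+1) :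
  chart_tame m (fun x => Re (affine_vec j x 0 l)) /\
  chart_tame m (fun x => Im (affine_vec j x 0 l)).
Proof.
under [X in chart_tame m X /\ _]eq_fun do rewrite mxE.
under [X in _ /\ chart_tame m X]eq_fun do rewrite mxE.
case: unlift => [q|]; last by split; exact: chart_tame_cst.
under [X in chart_tame m X /\ _]eq_fun do rewrite mxE.
under [X in _ /\ chart_tame m X]eq_fun do rewrite mxE.
by split; exact: chart_tame_coord.
Qed.

Lemma chart_tame_sqn m (j : 'I_k.+1) : chart_tame m (fun x => sqn (affine_vec j x)).
Proof.
apply: chart_tame_sum => l; have [tr ti] := chart_tame_affine_vec m j l.
by apply: tameD; apply: chart_tameM.
Qed.

Lemma chart_tame_herm m j (a : bool * 'I_k.+1 * 'I_k.+1) :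
  chart_tame m (fun x => herm a (affine_vec j x)).
Proof.
rewrite /herm; case: a => [[b l] p] /=.
have [tr ti] := chart_tame_affine_vec m j l; have [ur ui] := chart_tame_affine_vec m j p.
by case: b; [apply: chart_tameB|apply: tameD]; apply: chart_tameM.
Qed.

(** The entry at place [j] is 1, which keeps the denominator of the projection coordinates away from
    0 on the whole chart. *)
Lemma sqn_affine_vec_ge1 (j : 'I_k.+1) x : 1 <= sqn (affine_vec j x : 'rV[R[i]]_k.+1).
Proof.
have := sqn_ge (affine_vec j x) j; rewrite mxE unlift_none/=.
by rewrite expr1n expr0n addr0.
Qed.

Lemma proj_coord_affine_param a (j : 'I_k.+1) (x : 'rV[R]_(k + k)) :
  proj_coord a (affine_param j x) = herm a (affine_vec j x) * (sqn (affine_vec j x))^-1.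
Proof. exact: proj_coordE. Qed.

Lemma chart_tame_proj_coord m a (j : 'I_k.+1) :
  chart_tame m (proj_coord a \o affine_param j).
Proof.
rewrite (_ : _ \o _ = fun x => herm a (affine_vec j x) * (sqn (affine_vec j x))^-1).
  apply: chart_tameM; first exact: chart_tame_herm.
  by apply: tameV => [_ x|]; [exact: sqn_affine_vec_ge1|exact: chart_tame_sqn].
by apply/funext => x; exact: proj_coord_affine_param.
Qed.

Lemma continuous_proj_coord a : continuous (@proj_coord R k a).
Proof.
apply/continuousP => A oA.
suff : cproj_open (proj_coord a @^-1` A) by [].
move=> j; rewrite -comp_preimage; move: A oA; apply/continuousP.
exact: tame_cont (chart_tame_proj_coord 0 a j) tt.
Qed.

End Charts.

(** The centre [c i] disappears on differentiation, so the constants are uniform in it, and each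
    derivative of the inner function is [1 / e] times one of [G]. One order of [G] is spent on
    passing to its first derivative. *)
Lemma tame_grid_tile (R : realType) (V : normedModType R) (J I : Type) (v : J -> V)
    (B : set V) (e c : I -> R) (G : V -> R) m : (forall i, 0 < e i <= 1) ->
  tame v B (fun _ : unit => 1) m.+1 (fun _ _ => 1) (fun=> G) ->
  tame v B e m (fun i x => indic1 ((G x + 1) / e i - c i))
               (fun i x => tile ((G x + 1) / e i - c i)).
Proof.
move=> e01 tG; have [cG _ dG] := tG.
pose pos i x : R := (G x + 1) / e i - c i.
have dpos i x j : is_derive x (v j) (pos i)
    ((e i)^-1 * 'D_(v j) G x).
  have dGx : is_derive x (v j) G ('D_(v j) G x) by exact: derivableP ((dG j).1 tt x).
  apply: (@derive_ext _ _ ((e i)^-1 *: (G + cst 1) - cst (c i))).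
    by apply: is_derive_eq; rewrite subr0 addr0.
  by move=> y; rewrite /pos [_ / e i]mulrC.
apply: (@tame_comp _ _ _ _ _ _ _ _ indic1 tile pos).
- exact: tame_tile.
- move=> i x; apply: cvgB; last exact: cvg_cst.
  by apply: cvgM; [apply: cvgD; [exact: (cG tt)|exact: cvg_cst]|exact: cvg_cst].
- by move=> i x j; have [] := dpos i x j.
- move=> j; rewrite (_ : (fun i => 'D_(v j) (pos i)) =
      fun i x => (e i)^-1 * 'D_(v j) G x); last first.
    by apply/funext => i; apply/funext => x; have [_ ->] := dpos i x j.
  rewrite (_ : (fun i _ => (e i)^-1) = fun i (_ : V) => (e i)^-1 * 1); last first.
    by apply/funext => i; apply/funext => x; rewrite mulr1.
  apply: tameM.
    apply: (@tame_cst _ _ _ _ _ _ _ _ _ (fun i => (e i)^-1) 1) => // [i|i x _|i x _].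
    - by case/andP: (e01 i).
    - by case/andP: (e01 i) => /ltW; rewrite invr_ge0.
    - by case/andP: (e01 i) => /ltW ? _; rewrite mul1r ger0_norm// invr_ge0.
  apply: le_tame (tame_reindex (fun _ : I => tt) (dG j).2) => //= i x _.
  by rewrite invr1 mulr1 ler01 lexx.
Qed.

(** * The cutoff at scale [e] *)

Section Cutoff.
Context {R : realType} {k : nat}.
Variable (K : set (cproj R k)).
Implicit Types (e : R) (x y : cproj R k).
Local Notation index := (bool * 'I_k.+1 * 'I_k.+1)%type.

(** Projection coordinates lie in [[-1, 1]]; shifted and rescaled they fill [[0, 2 / e]], and
    [sum_tile] asks for at least [2 / e + 1] translates. *)
Definition grid_size e : nat := (Num.truncn (2 / e)).+2.

Local Notation cell e := {ffun index -> 'I_(grid_size e)}.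

Definition cell_coord e (m : cell e) x (a : index) : R :=
  (proj_coord a x + 1) / e - (m a)%:R.

(** The cell is the closed cube outside which the product of tiles vanishes. *)
Definition meets_cell e (m : cell e) : bool :=
  `[< exists2 y, K y & forall a, `|cell_coord m y a| <= 1 >].

Definition cutoff e x : R :=
  \sum_(m : cell e | meets_cell m) \prod_a tile (cell_coord m x a).

(** Distributivity turns the sum over cells into a product, over the coordinates, of one-dimensional
    sums equal to 1. *)
Lemma sum_cell e x : 0 < e -> \sum_(m : cell e) \prod_a tile (cell_coord m x a) = 1.
Proof.
move=> e0; rewrite -(bigA_distr_bigA (fun a (l : 'I_(grid_size e)) =>
  tile ((proj_coord a x + 1) / e - l%:R))).
apply: big1 => a _; have := norm_proj_coord_le a x.
rewrite ler_norml => /andP[p1 p2]; apply: sum_tile.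
  by rewrite divr_ge0 ?(ltW e0)//; lra.
rewrite /grid_size -natr1 lerD2r; apply: le_trans (ltW (truncnS_gt _)).
by rewrite ler_pM2r ?invr_gt0//; lra.
Qed.

Lemma cutoff_ge0 e x : 0 <= cutoff e x.
Proof. by apply: sumr_ge0 => m _; apply: prodr_ge0 => a _; exact: tile_ge0. Qed.

Lemma cutoff_le1 e x : 0 < e -> cutoff e x <= 1.
Proof.
move=> e0; rewrite -(sum_cell x e0) /cutoff big_mkcond; apply: ler_sum => m _.
by case: ifP => // _; apply: prodr_ge0 => a _; exact: tile_ge0.
Qed.

(** At a point of [K], the terms of the cells that miss [K] are zero, so leaving them out does not
    change the full sum 1. *)
Lemma cutoff_eq1 e x : 0 < e -> K x -> cutoff e x = 1.
Proof.
move=> e0 Kx; rewrite -(sum_cell x e0) /cutoff big_mkcond; apply: eq_bigr => m _.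
case: ifPn => // /asboolPn mx; apply/esym/eqP; rewrite prodf_seq_eq0.
have [a /negP] : exists a, ~ `|cell_coord m x a| <= 1.
  by apply/existsNP => h; apply: mx; exists x.
rewrite -ltNge => /tile_out b0; apply/hasP; exists a; first by rewrite mem_index_enum.
by rewrite b0 eqxx.
Qed.

(** Points of a common cell have coordinates at most [2 * e] apart, so [fs_dist_le] applies with
    [eta = 2 * e]; this gives the constant 12. *)
Lemma supp_cutoff e : 0 < e -> 12 * k.+1%:R ^+ 2 * e <= 1 ->
  forall delta : R, 12 * k.+1%:R ^+ 2 * e < delta ->
  supp (cutoff e) `<=` fs_nbhd K delta.
Proof.
move=> e0 e1 delta edelta.
(* The support is a closure, so the nonvanishing set is first enclosed in a finite union of closed
   cells. *)
pose C : set (cproj R k) := \bigcup_(m in [set m : cell e | meets_cell m])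
  \bigcap_a [set x | `|cell_coord m x a| <= 1].
have Cc : closed C.
  apply: closed_bigcup => [|m _]; first exact: finite_finset.
  apply: closed_bigI => a _.
  have cD : closed [set r : R | `|(r + 1) / e - (m a)%:R| <= 1].
    have cg : continuous (fun r : R => `|(r + 1) / e - (m a)%:R| : R).
      move=> r; apply: cvg_norm; apply: cvgB; last exact: cvg_cst.
      by apply: cvgM; [apply: cvgD; [exact: cvg_id|exact: cvg_cst]|exact: cvg_cst].
    exact: (continuous_closedP _).1 cg _ (@closed_le R 1).
  exact: (continuous_closedP _).1 (@continuous_proj_coord R k a) _ cD.
apply: (@subset_trans _ C).
  rewrite (closure_id C).1//; apply: closureS => x /= cx.
  have [m mm bm] : exists2 m : cell e, meets_cell m &
      \prod_a tile (cell_coord m x a) != 0.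
    apply/not_exists2P => h; move/eqP: cx; apply.
    apply: big1 => m mm; have [] := h m => // /negP; rewrite negbK => /eqP; exact.
  exists m => // a _ /=; rewrite leNgt; apply: contraNN bm => /tile_out b0.
  by rewrite (bigD1 a)//= b0 mul0r.
move=> x [m /= /asboolP[y Ky my] mx]; rewrite /fs_nbhd/=.
apply: (@le_lt_trans _ _ (6 * k.+1%:R ^+ 2 * (2 * e))%:E); last first.
  by rewrite lte_fin; lra.
apply: le_trans (_ : (fs_dist x y <= _)%E); first by apply: ereal_inf_lbound; exists y.
apply: fs_dist_le => [|a|]; [lra| |lra].
have : `|cell_coord m x a - cell_coord m y a| <= 2.
  apply: le_trans (ler_normB _ _) _.
  have := my a; have /= := mx a I; lra.
have -> : cell_coord m x a - cell_coord m y a =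
    (proj_coord a x - proj_coord a y) / e by rewrite /cell_coord; ring.
by rewrite normrM normfV (gtr0_norm e0) ler_pdivrMr.
Qed.

Lemma tame_cutoff (I : Type) (eps : I -> R) m (j : 'I_k.+1) :
  (forall i, 0 < eps i <= 1) ->
  tame (fun i : 'I_(k + k) => 'e_i) (@closed_polydisc R k) eps m
    (fun i w => \sum_(q : cell (eps i) | meets_cell q)
       \prod_a indic1 (cell_coord q (affine_param j w) a))
    (fun i => cutoff (eps i) \o affine_param j).
Proof.
move=> eps1.
apply: (@tame_sum _ _ _ _ _ _ _ _ (fun i => cell (eps i)) (fun i => @meets_cell (eps i))
  (fun t w => \prod_a indic1 (cell_coord (tagged t) (affine_param j w) a))
  (fun t w => \prod_a tile (cell_coord (tagged t) (affine_param j w) a))).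
apply: (@tame_prod _ _ _ _ _ _ _ _ _
  (fun a t w => indic1 (cell_coord (tagged t) (affine_param j w) a))
  (fun a t w => tile (cell_coord (tagged t) (affine_param j w) a))) => [t|a].
  exact: eps1.
pose c (t : {i : I & cell (eps i)}) : R := (tagged t a)%:R.
have et t : 0 < (eps \o @tag I (fun i => cell (eps i))) t <= 1 by exact: eps1.
have := tame_grid_tile c et (chart_tame_proj_coord m.+1 a j).
exact.
Qed.

Lemma indic1_ge0 (t : R) : 0 <= indic1 t. Proof. exact: ler0n. Qed.

Lemma sum_cell_indic1_ge0 e (P : pred (cell e)) x :
  0 <= \sum_(q : cell e | P q) \prod_a indic1 (cell_coord q x a).
Proof. by apply: sumr_ge0 => q _; apply: prodr_ge0 => a _; exact: indic1_ge0. Qed.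

(** Distributivity again: each coordinate contributes a factor at most 3, independently of [e]. *)
Lemma sum_cell_indic1 e (P : pred (cell e)) x :
  \sum_(q : cell e | P q) \prod_a indic1 (cell_coord q x a) <= 3 ^+ #|{: index}|.
Proof.
apply: (@le_trans _ _ (\sum_(q : cell e) \prod_a indic1 (cell_coord q x a))).
  rewrite big_mkcond; apply: ler_sum => q _.
  by case: ifP => // _; apply: prodr_ge0 => a _; exact: indic1_ge0.
rewrite -(bigA_distr_bigA (fun a (l : 'I_(grid_size e)) =>
  indic1 ((proj_coord a x + 1) / e - l%:R))) -prodr_const.
apply: ler_prod => a _; rewrite sum_indic1 andbT.
by apply: sumr_ge0 => l _; exact: indic1_ge0.
Qed.

Lemma Calpha_norm_cutoff (alpha : nat) : exists c : R, 0 <= c /\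
  forall e : R, 0 < e <= 1 -> (Calpha_norm alpha (cutoff e) <= (c * e ^- alpha)%:E)%E.
Proof.
(* All scales in [(0, 1]] form one family, so a single constant serves them all. *)
pose eps (i : {e : R | 0 < e <= 1}) := sval i.
have eps1 i : 0 < eps i <= 1 by exact: svalP i.
have /choice[c cP] j := tame_iter_partial (fun i => ltW (andP (eps1 i)).1)
  (fun i w _ => sum_cell_indic1_ge0 (@meets_cell _) (affine_param j w))
  (tame_cutoff alpha j eps1).
exists (\sum_j c j * 3 ^+ #|{: index}|); split.
  by apply: sumr_ge0 => j _; rewrite mulr_ge0 ?exprn_ge0//; have [] := cP j.
move=> e e1; have /andP[e0 e1'] := e1; apply: ge_ereal_sup => _ [j [s [w [sa Bw ->]]]].
rewrite lee_fin; have [c0 cj] := cP j.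
apply: le_trans (cj s sa (exist _ e e1) w Bw) _; rewrite /eps/=.
apply: (@le_trans _ _ (c j * 3 ^+ #|{: index}| * e ^- alpha)); last first.
  rewrite ler_wpM2r ?invr_ge0 ?exprn_ge0 ?(ltW e0)// (bigD1 j)//= lerDl.
  by apply: sumr_ge0 => j' _; rewrite mulr_ge0 ?exprn_ge0//; have [] := cP j'.
rewrite -mulrA ler_wpM2l// mulrC; apply: ler_pM; rewrite ?sum_cell_indic1_ge0//.
- by rewrite invr_ge0 exprn_ge0// ltW.
- exact: sum_cell_indic1.
(* Derivatives of order below [alpha] cost fewer factors [1 / e], and [e <= 1]. *)
by rewrite lef_pV2 ?posrE ?exprn_gt0// ler_wiXn2l// ltW.
Qed.

Lemma smooth_cutoff e : 0 < e <= 1 -> smooth (cutoff e).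
Proof.
move=> e1 j.
have eps1 (i : unit) : 0 < (fun=> e) i <= 1 by [].
exact: tame_smooth_on_Rn (fun m => tame_cutoff m j eps1) tt.
Qed.

End Cutoff.

(** * Choice of the scale for each [delta] *)

Unset Implicit Arguments.

Theorem lemma1p1 (R : realType) (k : nat) (hk : (1 <= k)%N)
    (delta0 : R) (hdelta0 : 0 < delta0)
    (K : set (cproj R k)) (cK : compact K) :
  exists chi : R -> cproj R k -> R,
    (forall delta : R, 0 < delta < delta0 ->
      [/\ smooth (chi delta),
          forall x, 0 <= chi delta x <= 1,
          forall x, K x -> chi delta x = 1 &
          supp (chi delta) `<=` fs_nbhd K delta]) /\
    (forall alpha : nat, exists c : R, 0 < c /\
      forall delta : R, 0 < delta < delta0 ->
        (Calpha_norm alpha (chi delta) <= (c * delta ^- alpha)%:E)%E).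
Proof.
pose n : R := k.+1%:R; have n1 : 1 <= n ^+ 2 by rewrite exprn_ege1// ler1n.
(* With [e = c0 * delta] the quantity [13 * n ^+ 2 * e] equals [delta / (1 + delta0)], which is
   below both 1 and [delta], as the scale and support conditions require. *)
pose c0 : R := (13 * n ^+ 2 * (1 + delta0))^-1.
have c0_gt0 : 0 < c0 by rewrite invr_gt0 !mulr_gt0//; lra.
have bound delta : 0 < delta < delta0 ->
    13 * n ^+ 2 * (c0 * delta) < 1 /\ 13 * n ^+ 2 * (c0 * delta) < delta.
  move=> /andP[d0 d1]; have -> : 13 * n ^+ 2 * (c0 * delta) = delta / (1 + delta0).
    by rewrite /c0; field; rewrite !gt_eqF//; lra.
  split; rewrite ltr_pdivrMr; nra.
have e01 delta : 0 < delta < delta0 -> 0 < c0 * delta <= 1.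
  move=> dd; have [b1 _] := bound _ dd; have /andP[d0 _] := dd.
  by rewrite mulr_gt0//=; have := mulr_gt0 c0_gt0 d0; nra.
exists (fun delta => cutoff K (c0 * delta)); split.
  move=> delta dd; have [b1 b2] := bound _ dd; have /andP[e0 e1] := e01 _ dd.
  have ne0 : 0 < n ^+ 2 * (c0 * delta) by rewrite mulr_gt0//; lra.
  split.
  - by apply: smooth_cutoff; exact: e01.
  - by move=> x; rewrite cutoff_ge0 cutoff_le1.
  - by move=> x; exact: cutoff_eq1.
  - by apply: supp_cutoff => //; rewrite -/n; lra.
move=> alpha; have [c [c_ge0 cP]] := Calpha_norm_cutoff K alpha.
(* The power of [c0] converts the scale back to [delta]; [c + 1] makes the constant positive. *)
exists ((c + 1) * c0 ^- alpha); split; first by rewrite mulr_gt0 ?invr_gt0 ?exprn_gt0//; lra.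
move=> delta dd; apply: le_trans (cP _ (e01 _ dd)) _; have /andP[d0 _] := dd.
rewrite lee_fin exprMn invfM mulrA ler_wpM2r ?invr_ge0 ?exprn_ge0 ?(ltW d0)//.
by rewrite ler_wpM2r ?invr_ge0 ?exprn_ge0 ?(ltW c0_gt0)// lerDl.
Qed.
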